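(* Let $n\ge2$. A linear map $\phi:\langle\mathbf{RS}_n\rangle\to\langle\mathbf{RS}_n\rangle$ preserves the spectrum, that is, $$\operatorname{spec}(\phi(A))=\operatorname{spec}(A)\qquad\text{for all }A\in\langle\mathbf{RS}_n\rangle,$$ if and only if $\phi$ has one of the following forms: (1) when $n=2$: $\phi(A)_{\mathbf{DS}}=PA_{\mathbf{DS}}P^{-1}$ for all $A\in\langle\mathbf{RS}_2\rangle$, for some $P\in\left\{I_2,\begin{pmatrix}1&0\\0&-1\end{pmatrix}\right\}$; (2) when $n\ge3$: there is an invertible $P\in\langle\mathbf{DS}_n\rangle$ such that either $\phi(A)_{\mathbf{DS}}=PA_{\mathbf{DS}}P^{-1}$ for all $A\in\langle\mathbf{RS}_n\rangle$, or $\phi(A)_{\mathbf{DS}}=P(A_{\mathbf{DS}})^tP^{-1}$ for all $A\in\langle\mathbf{RS}_n\rangle$.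
   Context: $\mathbf{DS}_n$ (resp. $\mathbf{RS}_n$) is the set of $n\times n$ doubly stochastic (resp. row stochastic) matrices: real, entrywise nonnegative, with all row sums and column sums (resp. all row sums) equal to $1$. $\langle\cdot\rangle$ denotes the real linear span. Let $e=(1,\ldots,1)^t\in\mathbb{R}^n$ and $R_n=\{ev^t: v\in\mathbb{R}^n,\ v^te=0\}$. One has the vector space direct sum $\langle\mathbf{RS}_n\rangle=\langle\mathbf{DS}_n\rangle\oplus R_n$, and for $A\in\langle\mathbf{RS}_n\rangle$ we write $A=A_{\mathbf{DS}}+A_R$ with $A_{\mathbf{DS}}\in\langle\mathbf{DS}_n\rangle$ and $A_R\in R_n$; explicitly, $A_R=er^t$ where $r_i=\frac1n\sum_{k}a_{ki}-\frac1{n^2}\sum_{k,l}a_{kl}$ and $A_{\mathbf{DS}}=A-A_R$. Linear means $\mathbb{R}$-linear. $\operatorname{spec}(A)$ is the spectrum (multiset of complex eigenvalues) counting multiplicities. *)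

(* Defs.v *)
From HB Require Import structures.
From mathcomp Require Import all_boot all_order all_algebra.
From mathcomp Require Import finmap multiset complex.
From mathcomp Require Import boolp classical_sets reals.
From mathcomp Require Import ring lra.

Set Implicit Arguments.
Unset Strict Implicit.
Unset Printing Implicit Defensive.

Import Order.TTheory GRing.Theory Num.Theory.
Local Open Scope ring_scope.
Local Open Scope classical_set_scope.

(* [vector.span] only applies to finite sequences; a vector lies in the span of
   an arbitrary set when it lies in the span of finitely many of its elements. *)
Definition in_lspan (K : fieldType) (V : vectType K) (S : set V) : {pred V} :=
  fun v => `[< exists2 s : seq V, [set` s] `<=` S & v \in <<s>>%VS >].

Section Lspan.
Variables (K : fieldType) (V : vectType K) (S : set V).

Lemma in_lspanP (v : V) :
  reflect (exists2 s : seq V, [set` s] `<=` S & v \in <<s>>%VS)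
          (v \in in_lspan S).
Proof. exact: asboolP. Qed.

Lemma in_lspan_submod : submod_closed (in_lspan S).
Proof.
split=> [|a u v /in_lspanP[s sS us] /in_lspanP[t tS vt]].
  by apply/in_lspanP; exists [::]; rewrite ?mem0v.
apply/in_lspanP; exists (s ++ t).
  by move=> x /=; rewrite mem_cat => /orP[/sS|/tS].
by rewrite span_cat memv_add ?memvZ.
Qed.

HB.instance Definition _ :=
  GRing.isSubmodClosed.Build K V (in_lspan S) in_lspan_submod.

Lemma mem_lspan (v : V) : S v -> v \in in_lspan S.
Proof.
move=> Sv; apply/in_lspanP; exists [:: v]; last by rewrite memv_span ?mem_head.
by move=> x /=; rewrite inE => /eqP ->.
Qed.

Record lspan := Lspan { lspan_val :> V; _ : lspan_val \in in_lspan S }.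

HB.instance Definition _ := [isSub for lspan_val].
HB.instance Definition _ := [Choice of lspan by <:].
HB.instance Definition _ := [SubChoice_isSubLmodule of lspan by <:].

End Lspan.

Section Stochastic.
Variables (R : realType) (n : nat).
Implicit Types A : 'M[R]_n.

Definition RS : set 'M[R]_n :=
  [set A | (forall i j, 0 <= A i j) /\ (forall i, \sum_j A i j = 1)].

Definition DS : set 'M[R]_n :=
  [set A | [/\ forall i j, 0 <= A i j,
               forall i, \sum_j A i j = 1 &
               forall j, \sum_i A i j = 1]].

Definition evec : 'cV[R]_n := const_mx 1.

Definition Rset : set 'M[R]_n :=
  [set A | exists2 v : 'cV[R]_n, v^T *m evec = 0 & A = evec *m v^T].

Definition Rvec A : 'cV[R]_n :=
  \col_i (n%:R^-1 * (\sum_k A k i) - (n%:R ^+ 2)^-1 * (\sum_k \sum_l A k l)).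

(* [DSpart A] and [Rpart A] are the components of A for the direct sum
   <RS> = <DS> (+) Rset: see [DSpartP], [RpartP] and [Rset_DS0] below. *)
Definition Rpart A : 'M[R]_n := evec *m (Rvec A)^T.

Definition DSpart A : 'M[R]_n := A - Rpart A.

(* The multiset of complex roots of the characteristic polynomial; see [specE]. *)
Definition spec A : {mset R[i]}%mset :=
  seq_mset (sval (closed_field_poly_normal
                    (char_poly (map_mx (real_complex R) A)))).

Lemma specE A (z : R[i]) :
  spec A z = mup z (char_poly (map_mx (real_complex R) A)).
Proof.
rewrite /spec mset_seqE; case: closed_field_poly_normal => s /=.
by rewrite (monicP (char_poly_monic _)) scale1r => ->; rewrite mu_prod_XsubC.
Qed.

(* The matrix diag(1, -1) when n = 2. *)
Definition altdiag : 'M[R]_n := diag_mx (\row_i (-1) ^+ i).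

Lemma sumRvec A : (0 < n)%N -> \sum_i Rvec A i 0 = 0.
Proof.
move=> n0; have nN0 : n%:R != 0 :> R by rewrite pnatr_eq0 -lt0n.
under eq_bigr do rewrite mxE.
rewrite sumrB -mulr_sumr sumr_const card_ord (exchange_big _ _ _ _ _ (fun i j => A j i)) /=.
by rewrite -[X in _ - X]mulr_natl; field.
Qed.

Lemma RpartP A : (0 < n)%N -> Rset (Rpart A).
Proof.
move=> n0; exists (Rvec A) => //; apply/matrixP => i j.
rewrite !mxE -[RHS](sumRvec A n0) ord1; apply: eq_bigr => k _.
by rewrite !mxE mulr1.
Qed.

Lemma in_lspan_RS A : A \in in_lspan RS ->
  forall i j, \sum_k A i k = \sum_k A j k.
Proof.
move=> /in_lspanP[s sRS] /(@coord_span _ _ _ (in_tuple s)) -> i j.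
suff sumE k : \sum_l (\sum_(m < size s) coord (in_tuple s) m A *: s`_m) k l =
    \sum_(m < size s) coord (in_tuple s) m A by rewrite !sumE.
under eq_bigr do rewrite summxE; rewrite exchange_big; apply: eq_bigr => m _.
under eq_bigr do rewrite mxE.
by rewrite -mulr_sumr (sRS _ (mem_nth 0 (ltn_ord m))).2 mulr1.
Qed.

Lemma in_lspan_DS A (s : R) : (0 < n)%N ->
  (forall i, \sum_j A i j = s) -> (forall j, \sum_i A i j = s) ->
  A \in in_lspan DS.
Proof.
move=> n0 rowA colA; have nN0 : n%:R != 0 :> R by rewrite pnatr_eq0 -lt0n.
pose c := 1 + \sum_k \sum_l `|A k l|.
have Ac i j : 0 < A i j + c.
  have : `|A i j| <= \sum_k \sum_l `|A k l|.
    rewrite (bigD1 i) //= (bigD1 j) //= -addrA lerDl addr_ge0 ?sumr_ge0 // => k _.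
    by rewrite sumr_ge0.
  by move=> /ler_normlP[]; rewrite /c; lra.
pose t := s + c *+ n.
have t0 : 0 < t.
  rewrite /t -(rowA (Ordinal n0)) -[X in _ *+ X]card_ord -sumr_const -big_split.
  rewrite (bigD1 (Ordinal n0)) //= ltr_pwDl ?Ac // sumr_ge0 // => i _.
  exact: ltW (Ac _ _).
have -> : A = t *: (t^-1 *: (A + const_mx c)) - (c * n%:R) *: const_mx n%:R^-1.
  rewrite scalerA mulfV ?gt_eqF // scale1r scalemx_const mulfK //.
  by rewrite addrK.
apply: rpredB; apply/rpredZ/mem_lspan; split=> [i j|i|j].
- by rewrite !mxE mulr_ge0 ?invr_ge0 // ltW.
- under eq_bigr do rewrite !mxE.
  by rewrite -mulr_sumr big_split /= rowA sumr_const card_ord mulVf ?gt_eqF.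
- under eq_bigr do rewrite !mxE.
  by rewrite -mulr_sumr big_split /= colA sumr_const card_ord mulVf ?gt_eqF.
- by rewrite mxE invr_ge0.
- under eq_bigr do rewrite mxE.
  by rewrite sumr_const card_ord -[LHS]mulr_natl mulfV.
- under eq_bigr do rewrite mxE.
  by rewrite sumr_const card_ord -[LHS]mulr_natl mulfV.
Qed.

Lemma DSpartP A : (0 < n)%N -> A \in in_lspan RS -> DSpart A \in in_lspan DS.
Proof.
move=> n0 /in_lspan_RS rowA.
have nN0 : n%:R != 0 :> R by rewrite pnatr_eq0 -lt0n.
pose s := \sum_k A (Ordinal n0) k.
have DSE i j : DSpart A i j = A i j - Rvec A j 0.
  by rewrite !mxE big_ord1 !mxE mul1r.
apply: (@in_lspan_DS _ s) => // [i|j].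
  under eq_bigr do rewrite DSE.
  by rewrite sumrB sumRvec // subr0 (rowA i (Ordinal n0)).
under eq_bigr do rewrite DSE.
rewrite sumrB sumr_const card_ord mxE.
under [X in _ - (_ - _ * X) *+ _]eq_bigr do rewrite (rowA _ (Ordinal n0)).
rewrite sumr_const card_ord -/s -[_ *+ n]mulr_natl -[s *+ n]mulr_natl.
by field.
Qed.

Lemma in_lspan_DS_col A : A \in in_lspan DS ->
  forall i j, \sum_k A k i = \sum_k A k j.
Proof.
move=> /in_lspanP[s sDS] /(@coord_span _ _ _ (in_tuple s)) -> i j.
suff sumE k : \sum_l (\sum_(m < size s) coord (in_tuple s) m A *: s`_m) l k =
    \sum_(m < size s) coord (in_tuple s) m A by rewrite !sumE.
under eq_bigr do rewrite summxE; rewrite exchange_big; apply: eq_bigr => m _.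
under eq_bigr do rewrite mxE.
have [_ _ col1] := sDS _ (mem_nth 0 (ltn_ord m)).
by rewrite -mulr_sumr col1 mulr1.
Qed.

Lemma Rset_DS0 A : Rset A -> A \in in_lspan DS -> A = 0.
Proof.
move=> [v ve0 ->] /in_lspan_DS_col evE.
have AE i j : (evec *m v^T) i j = v j 0.
  by rewrite !mxE big_ord1 !mxE mul1r.
have {}ve0 : \sum_j v j 0 = 0.
  move/matrixP: ve0 => /(_ 0 0); rewrite !mxE => sum0.
  by rewrite -[RHS]sum0; apply: eq_bigr => j _; rewrite !mxE mulr1.
apply/matrixP => i j; rewrite AE mxE.
have nN0 : n%:R != 0 :> R by rewrite pnatr_eq0 -lt0n (leq_trans _ (ltn_ord i)).
have vE k : v k 0 = v j 0.
  have := evE k j; under eq_bigr do rewrite AE.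
  under [RHS]eq_bigr do rewrite AE.
  by rewrite !sumr_const card_ord -mulr_natl -[RHS]mulr_natl => /(mulfI nN0).
move: ve0; under eq_bigr do rewrite vE.
rewrite sumr_const card_ord -[LHS]mulr_natl => /eqP.
by rewrite mulf_eq0 (negPf nN0) => /eqP.
Qed.

End Stochastic.

Arguments RS : clear implicits.
Arguments DS : clear implicits.
Arguments Rset : clear implicits.
Arguments evec : clear implicits.
Arguments altdiag : clear implicits.

(* Main.v *)
From HB Require Import structures.
Require Import Defs.
From mathcomp Require Import all_boot all_order all_algebra.
From mathcomp Require Import reals.
From mathcomp Require Import finmap multiset complex boolp ring.

Set Implicit Arguments.
Unset Strict Implicit.
Unset Printing Implicit Defensive.

Import GRing.Theory Num.Theory.
Local Open Scope ring_scope.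

(** Let E be the matrix with all entries 1/n, an idempotent of rank one. Row
sums of A are equal exactly when EAE = AE, and row and column sums of A all
agree exactly when AE = EA. So <DS> is the commutant of E, which splits as the
direct sum of the line spanned by E and of the corner (1-E)M(1-E), a matrix
algebra of order n-1; on <RS> the component A_DS is A - EA + EAE, the block
diagonal part of the block triangular matrix A, so A and A_DS have the same
characteristic polynomial ([char_poly_DSpart]).  This already shows that the
listed maps preserve the spectrum.

Conversely let phi preserve the spectrum and let psi be the map A |-> phi(A)_DS
on <DS> ([ds_map]).  The characteristic polynomial determines the traces of A^2
and A^3; polarizing, phi preserves tr(AB) and tr(AAB), computed on the
components in <DS> ([eq_char_poly_mxtrace_mul],
[eq_char_poly_mxtrace_sqr_mul]).  The trace form is nondegenerate on <DS>, so
- psi is injective, hence onto ([comm_trace_surj]);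
- phi(A)_DS depends on A_DS alone ([ds_phiE]);
- tr((psi(AA) - psi(A)psi(A)) psi(B)) = 0 for all B, that is
  psi(AA) = psi(A)psi(A) ([ds_map_sqr]): psi is a Jordan automorphism.

When n = 2 the algebra <DS> is spanned by E and 1-E, and the preserved traces
leave only the identity and the exchange of E and 1-E, which is conjugation by
diag(1, -1).

When n >= 3 the corner has order at least 2, and the multiples of E are then
the only F such that all products FY with Y in <DS> lie on the line of F; psi
preserves this property, so it fixes E ([comm_psi_E]) and restricts to a
Jordan automorphism of the corner.  Such a map is multiplicative or
antimultiplicative ([jordan_mult_or_antimult]), hence conjugation by some T,
possibly after transposition ([mult_surj_inner]).
Gluing T with the identity on E gives the matrix P ([commutant_jordan_inner]),
which commutes with E and so lies in <DS>. *)

(** * Jordan endomorphisms of a matrix algebra *)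

(** For noncommutative identities: distribute, treat every monomial as an atom,
and check the additive identity that remains entry by entry. *)
Ltac zmod :=
  try rewrite !(mulrDl, mulrDr, mulrN, mulNr, mulrA, opprD, opprK);
  repeat match goal with |- context[@GRing.mul ?T ?a ?b] =>
    let x := fresh in set x := (@GRing.mul T a b); move: x => ?
  end;
  apply/matrixP => ? ?; rewrite !mxE; ring.

(** A group is not the union of two proper subgroups: if x is outside P and y
outside Q, then x - y is in neither. *)
Lemma subgroup_alternative (U : zmodType) (P Q : U -> Prop) :
  (forall x y, P x -> P y -> P (x - y)) ->
  (forall x y, Q x -> Q y -> Q (x - y)) ->
  (forall x, P x \/ Q x) -> (forall x, P x) \/ (forall x, Q x).
Proof.
move=> PB QB PQ; have [?|/existsNP[x nPx]] := EM (forall x, P x); first by left.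
have [?|/existsNP[y nQy]] := EM (forall x, Q x); first by right.
have Qx : Q x by case: (PQ x).
have Py : P y by case: (PQ y).
have [Pxy|Qxy] := PQ (x - y).
  have Py' := PB _ _ (PB _ _ Py Py) Py.
  by case: nPx; have := PB _ _ Pxy Py'; rewrite subrr sub0r opprK subrK.
by case: nQy; have := QB _ _ Qx Qxy; rewrite opprB addrCA subrr addr0.
Qed.

(** Taking for Z the matrix units makes the hypothesis entrywise:
A i j * B k l + B i j * A k l = 0.  A nonzero entry of A then kills the same
entry of B, and after that every entry of B. *)
Lemma mx_jordan_prime (F : fieldType) (m : nat) (A B : 'M[F]_m) :
  2 != 0 :> F -> (forall Z, A * Z * B + B * Z * A = 0) -> A = 0 \/ B = 0.
Proof.
move=> two_neq0 AZB.
have AB i j k l : A i j * B k l + B i j * A k l = 0.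
  have /matrixP/(_ i l) := AZB (delta_mx j k).
  have E (M N : 'M[F]_m) : (M * delta_mx j k * N) i l = M i j * N k l.
    rewrite -!mulmxE -(mul_delta_mx (0 : 'I_1)) mulmxA -mulmxA -colE -rowE.
    by rewrite !mxE big_ord1 !mxE.
  by rewrite mxE !E mxE.
have [->|/matrix0Pn[i [j Aij]]] := eqVneq A 0; [by left | right].
have Bij : B i j = 0.
  have := AB i j i j; rewrite [B i j * _]mulrC -mulr2n -mulr_natl => /eqP.
  by rewrite !mulf_eq0 (negPf two_neq0) (negPf Aij) => /eqP.
apply/matrixP=> k l; have := AB i j k l; rewrite Bij mul0r addr0 mxE => /eqP.
by rewrite mulf_eq0 (negPf Aij) => /eqP.
Qed.

Section Jordan.
Variables (F : fieldType) (m : nat) (theta : {linear 'M[F]_m -> 'M[F]_m}).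
Hypothesis two_neq0 : 2 != 0 :> F.
Hypothesis theta_sqr : forall X, theta (X * X) = theta X * theta X.
Implicit Types X Y Z A B : 'M[F]_m.

Let thD X Y : theta (X + Y) = theta X + theta Y. Proof. exact: linearD. Qed.
Let thB X Y : theta (X - Y) = theta X - theta Y. Proof. exact: linearB. Qed.

Lemma jordan_anticomm X Y :
  theta (X * Y + Y * X) = theta X * theta Y + theta Y * theta X.
Proof.
have -> : X * Y + Y * X = (X + Y) * (X + Y) - X * X - Y * Y by zmod.
by rewrite !thB !theta_sqr thD; zmod.
Qed.

(** With the notation X o Y = XY + YX, this comes from
2 XYX = X o (X o Y) - (XX) o Y. *)
Lemma jordan_triple X Y : theta (X * Y * X) = theta X * theta Y * theta X.
Proof.
apply: (scalerI two_neq0); rewrite !scaler_nat !mulr2n -thD.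
have -> : X * Y * X + X * Y * X = X * (X * Y + Y * X) + (X * Y + Y * X) * X
    - (X * X * Y + Y * (X * X)) by zmod.
by rewrite thB !jordan_anticomm theta_sqr; zmod.
Qed.

Lemma jordan_triple_polar X Y Z :
  theta (X * Y * Z + Z * Y * X) =
  theta X * theta Y * theta Z + theta Z * theta Y * theta X.
Proof.
have -> : X * Y * Z + Z * Y * X =
    (X + Z) * Y * (X + Z) - X * Y * X - Z * Y * Z by zmod.
by rewrite !thB !jordan_triple thD; zmod.
Qed.

(** The failures of multiplicativity and of antimultiplicativity at (X, Y)
annihilate each other.  Both decompositions
XY.Z.YX + YX.Z.XY = X(YZY)X + Y(XZX)Y are mapped by the triple identities, and
the difference of the two images is the left-hand side. *)
Lemma jordan_defect X Y Z (a := theta (X * Y) - theta X * theta Y)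
    (b := theta (X * Y) - theta Y * theta X) :
  a * theta Z * b + b * theta Z * a = 0.
Proof.
have thYX : theta (Y * X) = theta X * theta Y + theta Y * theta X - theta (X * Y).
  by rewrite -jordan_anticomm thD addrC addKr.
have := jordan_triple_polar (X * Y) Z (Y * X).
have -> : X * Y * Z * (Y * X) + Y * X * Z * (X * Y) =
  X * (Y * Z * Y) * X + Y * (X * Z * X) * Y by rewrite !mulrA.
rewrite thD !jordan_triple thYX /a /b => h.
have -> : 0 = theta X * (theta Y * theta Z * theta Y) * theta X +
  theta Y * (theta X * theta Z * theta X) * theta Y -
  (theta X * (theta Y * theta Z * theta Y) * theta X +
  theta Y * (theta X * theta Z * theta X) * theta Y) by rewrite subrr.
by rewrite {2}h; zmod.
Qed.

Hypothesis theta_surj : forall Y, exists X, theta X = Y.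

(** At each pair (X, Y) one of the two defects vanishes by primeness.  For fixed
X the Y where a given defect vanishes form a subgroup, and so do the X where
it vanishes for all Y; hence the same alternative holds at all pairs. *)
Lemma jordan_mult_or_antimult :
  (forall X Y, theta (X * Y) = theta X * theta Y) \/
  (forall X Y, theta (X * Y) = theta Y * theta X).
Proof.
pose P X Y := theta (X * Y) = theta X * theta Y.
pose Q X Y := theta (X * Y) = theta Y * theta X.
apply: (@subgroup_alternative _ (fun X => forall Y, P X Y)
          (fun X => forall Y, Q X Y)) => [X1 X2 h1 h2 Y|X1 X2 h1 h2 Y|X].
- by rewrite /P mulrBl !thB h1 h2 mulrBl.
- by rewrite /Q mulrBl !thB h1 h2 mulrBr.
apply: subgroup_alternative => [Y1 Y2 h1 h2|Y1 Y2 h1 h2|Y].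
- by rewrite /P mulrBr !thB h1 h2 mulrBr.
- by rewrite /Q mulrBr !thB h1 h2 mulrBl.
have [|/eqP|/eqP] := @mx_jordan_prime _ _ (theta (X * Y) - theta X * theta Y)
  (theta (X * Y) - theta Y * theta X) two_neq0.
- by move=> Z; have [Z' <-] := theta_surj Z; exact: jordan_defect.
- by rewrite subr_eq0 => /eqP; left.
- by rewrite subr_eq0 => /eqP; right.
Qed.

End Jordan.

(** On column vectors put T x = theta(x e^t) u, where e is the first basis vector
and u is chosen so that theta(e e^t) u != 0.  Multiplicativity gives
T (X x) = theta(X) (T x).  The kernel of T is then stable under all matrices,
so a nonzero vector in it would put e there, although T e != 0. *)
Lemma mult_surj_inner (F : fieldType) (m : nat)
    (theta : {linear 'M[F]_m -> 'M[F]_m}) :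
  (forall X Y, theta (X * Y) = theta X * theta Y) ->
  (forall Y, exists X, theta X = Y) ->
  exists2 T : 'M[F]_m, T \in unitmx &
    forall X, theta X = T * X * invmx T.
Proof.
case: m theta => [|m] theta thM th_surj.
  exists 1%:M; first exact: unitmx1.
  by move=> X; rewrite [theta X]flatmx0 [RHS]flatmx0.
pose i0 : 'I_m.+1 := ord0.
(* Otherwise theta kills one matrix unit, hence all of them. *)
have [k tk] : exists k, theta (delta_mx i0 i0) *m delta_mx k ord0 != 0 :> 'cV_m.+1.
  apply/existsP; apply: contraT; rewrite negb_exists => /forallP h.
  have t0 : theta (delta_mx i0 i0) = 0.
    apply/matrixP=> i j; have := h j; rewrite negbK => /eqP/matrixP/(_ i ord0).
    by rewrite -colE !mxE.
  have t0' i j : theta (delta_mx i j) = 0.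
    have -> : delta_mx i j = delta_mx i i0 * delta_mx i0 i0 * delta_mx i0 j :> 'M[F]_m.+1.
      by rewrite -!mulmxE !mul_delta_mx.
    by rewrite !thM t0 mulr0 mul0r.
  have [X X1] := th_surj 1.
  move: X1; rewrite (matrix_sum_delta X) linear_sum big1 => [|i _].
    by move/eqP; rewrite eq_sym oner_eq0.
  by rewrite linear_sum big1 // => j _; rewrite linearZ /= t0' scaler0.
pose u : 'cV[F]_m.+1 := delta_mx k ord0.
pose T : 'M[F]_m.+1 := \matrix_(i, j) (theta (delta_mx j i0) *m u) i ord0.
have TE (x : 'cV_m.+1) : T *m x = theta (x *m delta_mx ord0 i0) *m u.
  have -> : x *m delta_mx ord0 i0 = \sum_l x l ord0 *: delta_mx l i0.
    apply/matrixP=> a b; rewrite summxE !mxE big_ord1 !mxE eqxx /=.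
    rewrite (bigD1 a) //= big1 => [|c ca]; first by rewrite !mxE eqxx addr0.
    by rewrite !mxE eq_sym (negPf ca) mulr0.
  rewrite linear_sum mulmx_suml; apply/matrixP=> i j.
  rewrite ord1 summxE mxE; apply: eq_bigr => l _.
  by rewrite linearZ /= -scalemxAl mxE [RHS]mxE mulrC.
have TA X (x : 'cV_m.+1) : T *m (X *m x) = theta X *m (T *m x).
  by rewrite !TE mulmxA -[theta X *m _]thM -mulmxA.
have TM X : T *m X = theta X *m T.
  apply/matrixP=> i j.
  by have /matrixP/(_ i ord0) := TA X (delta_mx j ord0); rewrite !mulmxA -!colE !mxE.
have Tu : T \in unitmx.
  rewrite -unitmx_tr -row_free_unit -kermx_eq0; apply/eqP/row_matrixP=> i.
  rewrite row0; apply: contraTeq tk => /[dup] xn0; set x := row i _ => {}xn0.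
  have [l xl] : exists l, x 0 l != 0.
    apply/existsP; apply: contraNT xn0; rewrite negb_exists => /forallP h.
    apply/eqP/rowP=> b; have := h b; rewrite negbK => /eqP.
    by move=> ->; rewrite [RHS]mxE.
  have Tx : T *m x^T = 0.
    by apply: trmx_inj; rewrite trmx_mul trmxK trmx0 -row_mul mulmx_ker row0.
  (* x spans a line that matrices can move anywhere: e e^t factors through x. *)
  clearbody x; rewrite negbK; apply/eqP; rewrite -/u.
  have -> : delta_mx i0 i0 =
     ((x 0 l)^-1 *: (delta_mx i0 l *m x^T)) *m delta_mx ord0 i0 :> 'M[F]_m.+1.
    rewrite -scalemxAl -[delta_mx i0 l](@mul_delta_mx _ _ 1 _ ord0) -!mulmxA.
    rewrite [_ *m (_ *m delta_mx _ _)]mulmxA -rowE.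
    rewrite [row l x^T]mx11_scalar !mxE mul_scalar_mx -scalemxAr scalerA.
    by rewrite mulVf // scale1r mul_delta_mx.
  by rewrite -TE -scalemxAr mulmxA TM -mulmxA Tx mulmx0 scaler0.
by exists T => // X; rewrite -mulmxE TM mulmxK.
Qed.

(** * Traces of powers and the characteristic polynomial *)

Lemma char_poly_conj (F : fieldType) n (P A : 'M[F]_n) : P \in unitmx ->
  char_poly (P *m A *m invmx P) = char_poly A.
Proof.
move=> Pu; pose Q := map_mx polyC P; pose Q' := map_mx polyC (invmx P).
have QQ' : Q *m Q' = 1%:M by rewrite -map_mxM mulmxV // map_mx1.
have cE : char_poly_mx (P *m A *m invmx P) = Q *m char_poly_mx A *m Q'.
  rewrite /char_poly_mx mulmxBr mulmxBl !map_mxM; congr (_ - _).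
  by rewrite scalar_mxC -mulmxA QQ' mulmx1.
rewrite /char_poly cE !det_mulmx mulrAC -det_mulmx QQ' det1 mul1r //.
Qed.

Lemma trig_mxM (R : pzRingType) n (A B : 'M[R]_n) :
  is_trig_mx A -> is_trig_mx B ->
  is_trig_mx (A *m B) /\ forall i, (A *m B) i i = A i i * B i i.
Proof.
move=> /is_trig_mxP tA /is_trig_mxP tB; split=> [|i].
  apply/is_trig_mxP=> i j ij; rewrite mxE big1 // => k _.
  have [ik|ki] := ltnP i k; first by rewrite tA // mul0r.
  by rewrite tB ?mulr0 // (leq_ltn_trans ki).
rewrite mxE (bigD1 i) //= big1 ?addr0 // => k; rewrite neq_ltn.
by case/orP=> h; [rewrite tB // mulr0 | rewrite tA // mul0r].
Qed.

Lemma trig_mxX (R : pzRingType) n (A : 'M[R]_n) k : is_trig_mx A ->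
  is_trig_mx (A ^+ k) /\ forall i, (A ^+ k) i i = A i i ^+ k.
Proof.
move=> tA; elim: k => [|k [tAk dAk]].
  by rewrite expr0; split=> [|i]; [exact: scalar_mx_is_trig | rewrite !mxE eqxx].
rewrite exprS; have [tM dM] := trig_mxM tA tAk.
by split=> // i; rewrite dM dAk exprS.
Qed.

(** Triangularize A: the diagonal of a triangular matrix lists the roots of its
characteristic polynomial, and the diagonal of its k-th power their k-th
powers. *)
Lemma mxtraceX_roots (C : numClosedFieldType) n (A : 'M[C]_n) (s : seq C) k :
  char_poly A = \prod_(z <- s) ('X - z%:P) -> \tr (A ^+ k) = \sum_(z <- s) z ^+ k.
Proof.
have [|P Pun /andP[]] := @cotrigonalization C n [:: A].
  by move=> X Y; rewrite !inE => /eqP-> /eqP->.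
have Pu := unitarymx_unit Pun.
move=> tT _ cA; have {tT} : is_trig_mx (conjmx P A) by [].
rewrite conjumx //; set T := _ *m _ => tT.
have AE : A = invmx P *m T *m P by rewrite /T !mulmxA mulVmx // mul1mx mulmxKV.
have AX : A ^+ k = invmx P *m (T ^+ k) *m P.
  elim: k => [|k IH]; first by rewrite !expr0 mulmx1 mulVmx.
  by rewrite !exprS IH {1}AE -!mulmxE !mulmxA mulmxK.
have /prod_XsubC_eq sE : \prod_(z <- s) ('X - z%:P) =
    \prod_(z <- [seq T i i | i <- enum 'I_n]) ('X - z%:P).
  by rewrite -cA -(char_poly_conj A Pu) -/T char_poly_trig // big_map big_enum.
have [_ dT] := trig_mxX k tT.
rewrite AX mxtrace_mulC mulmxA mulmxV // mul1mx (perm_big _ sE) /= big_map big_enum.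
by apply: eq_bigr => i _; rewrite dT.
Qed.

Lemma eq_char_poly_mxtraceX (R : rcfType) n (A B : 'M[R]_n) k :
  char_poly A = char_poly B -> \tr (A ^+ k) = \tr (B ^+ k).
Proof.
move=> cAB; pose C (M : 'M[R]_n) : 'M[R[i]]_n := map_mx (real_complex R) M.
have CX M : C (M ^+ k) = C M ^+ k.
  elim: k => [|j IH]; first by rewrite !expr0; exact: map_mx1.
  by rewrite !exprS -IH; exact: map_mxM.
have [s sE] := closed_field_poly_normal (char_poly (C A)).
rewrite (monicP (char_poly_monic _)) scale1r in sE.
apply: (@complexI R); rewrite -!trace_map_mx -!/(C _) !CX (mxtraceX_roots k sE).
have cCAB : char_poly (C A) = char_poly (C B).
  by rewrite -[LHS]map_char_poly -[RHS]map_char_poly cAB.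
by rewrite (mxtraceX_roots k (etrans (esym cCAB) sE)).
Qed.

Lemma spec_char_poly (R : realType) n (A B : 'M[R]_n) :
  spec A = spec B <-> char_poly A = char_poly B.
Proof.
split=> [AB|AB]; last first.
  have cAB : char_poly (map_mx (real_complex R) A) =
      char_poly (map_mx (real_complex R) B).
    by rewrite -[LHS]map_char_poly -[RHS]map_char_poly AB.
  by apply/msetP=> z; rewrite [LHS]specE [RHS]specE cAB.
apply: (map_poly_inj (real_complex R)); rewrite !map_char_poly.
have split M : exists s : seq R[i],
    char_poly (map_mx (real_complex R) M) = \prod_(z <- s) ('X - z%:P).
  have [s sE] := closed_field_poly_normal (char_poly (map_mx (real_complex R) M)).
  by exists s; rewrite [LHS]sE (monicP (char_poly_monic _)) scale1r.
have [[s sE] [t tE]] := (split n A, split n B).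
rewrite sE tE; apply/perm_big/allP=> z _ /=; apply/eqP.
rewrite -[LHS]mu_prod_XsubC -[RHS]mu_prod_XsubC -sE -tE.
by rewrite -[LHS]specE -[RHS]specE AB.
Qed.

(** The traces of squares and cubes determine, by linearity in u and v, the
bilinear form tr(XY) and the form tr(XXY). *)
Section Polarization.
Variables (R : rcfType) (n : nat) (U : lmodType R).
Variables (f g : {linear U -> 'M[R]_n}).
Hypothesis fg : forall u, char_poly (f u) = char_poly (g u).

Lemma eq_char_poly_mxtrace u : \tr (f u) = \tr (g u).
Proof. by have := eq_char_poly_mxtraceX 1 (fg u); rewrite !expr1. Qed.

Lemma eq_char_poly_mxtrace_mul u v : \tr (f u *m f v) = \tr (g u *m g v).
Proof.
have two_neq0 : 2 != 0 :> R by rewrite pnatr_eq0.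
have E (h : {linear U -> 'M[R]_n}) : \tr (h u *m h v) * 2 =
   \tr (h (u + v) ^+ 2) - \tr (h u ^+ 2) - \tr (h v ^+ 2).
  rewrite linearD !expr2 -!mulmxE mulmxDl !mulmxDr !mxtraceD.
  by rewrite (mxtrace_mulC (h v) (h u)); ring.
by apply: (mulIf two_neq0); rewrite !E !(eq_char_poly_mxtraceX 2 (fg _)).
Qed.

Lemma eq_char_poly_mxtrace_sqr_mul u v :
  \tr (f u *m f u *m f v) = \tr (g u *m g u *m g v).
Proof.
have six_neq0 : 6 != 0 :> R by rewrite pnatr_eq0.
have E (h : {linear U -> 'M[R]_n}) : \tr (h u *m h u *m h v) * 6 =
   \tr (h (u + v) ^+ 3) - \tr (h (u - v) ^+ 3) - \tr (h v ^+ 3) * 2.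
  have trN (X : 'M[R]_n) : \tr (- X) = - \tr X by exact: raddfN.
  rewrite linearD linearB !exprSr !expr0 !mul1r -!mulmxE.
  rewrite !(mulmxDl, mulmxDr, mulmxN, mulNmx, opprK) !(mxtraceD, trN).
  set a := h u; set b := h v.
  (* By cyclicity only tr(aab) and tr(bba) occur; the latter cancel. *)
  have e1 : \tr (a *m b *m a) = \tr (a *m a *m b).
    by rewrite mxtrace_mulC mulmxA.
  have e2 : \tr (b *m a *m a) = \tr (a *m a *m b).
    by rewrite -mulmxA mxtrace_mulC.
  have e3 : \tr (a *m b *m b) = \tr (b *m b *m a).
    by rewrite -mulmxA mxtrace_mulC.
  have e4 : \tr (b *m a *m b) = \tr (b *m b *m a).
    by rewrite mxtrace_mulC mulmxA.
  by rewrite ?e1 ?e2 ?e3 ?e4; ring.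
by apply: (mulIf six_neq0); rewrite !E !(eq_char_poly_mxtraceX 3 (fg _)).
Qed.

End Polarization.

(** * Block triangular matrices *)

(** In block form with respect to E, where M = diag(M1, M2) and N is the upper
right block, this is
(M1, -N; 0, M2) = (1, 0; 0, M2) (1, -N; 0, 1) (M1, 0; 0, 1). *)
Lemma triangular_factor (S : comNzRingType) n (E M N : 'M[S]_n) :
  E *m E = E -> M *m E = E *m M -> E *m N = N -> N *m E = 0 ->
  M - N = (E + M *m (1%:M - E)) *m (1%:M - N) *m (E *m M + (1%:M - E)).
Proof.
move=> EE ME EN NE.
have e1 : (E + M *m (1%:M - E)) *m (1%:M - N) = E - N + (M - E *m M).
  rewrite !(mulmxDl, mulmxDr, mulmxN, mulNmx, mulmx1, mul1mx).
  rewrite -[M *m E *m N]mulmxA EN ME.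
  move: (E *m M) (M *m N) => X Y; apply/matrixP=> i j; rewrite !mxE; ring.
rewrite e1 !(mulmxDl, mulmxDr, mulmxN, mulNmx, mulmx1, mul1mx, mulmxA).
rewrite -[E *m M *m E]mulmxA ME !(mulmxA, EE) NE mul0mx.
move: (E *m M *m M) => X; apply/matrixP=> i j; rewrite !mxE; ring.
Qed.

(** The reflection c = 2E - 1 conjugates 1 - h to 1 + h for h = N/2, so
det(1 - N) = det(1 - h)^2 = det(1 - h) det(1 + h) = det(1 - hh) = 1. *)
Lemma det_unipotent (F : fieldType) n (E N : 'M[F]_n) : 2 != 0 :> F ->
  E *m N = N -> N *m E = 0 -> E *m E = E -> \det (1%:M - N) = 1.
Proof.
move=> two_neq0 EN NE EE; pose h := 2^-1 *: N; pose c := E + E - 1%:M.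
have hh : h + h = N by rewrite -scalerDl -mulr2n -[2^-1 *+ 2]mulr_natl mulfV // scale1r.
have Eh : E *m h = h by rewrite -scalemxAr EN.
have hE : h *m E = 0 by rewrite -scalemxAl NE scaler0.
have h2 : h *m h = 0 by rewrite -{2}Eh mulmxA hE mul0mx.
have cc : c *m c = 1%:M.
  rewrite !(mulmxDl, mulmxDr, mulmxN, mulNmx, mulmx1, mul1mx, EE).
  by apply/matrixP=> i j; rewrite !mxE; ring.
have ch : c *m h = h by rewrite !(mulmxDl, mulNmx, mul1mx, Eh) addrK.
have hc : h *m c = - h by rewrite !(mulmxDr, mulmxN, mulmx1, hE) addr0 add0r.
have chc : c *m (1%:M - h) *m c = 1%:M + h.
  clearbody c; rewrite mulmxBr mulmx1 mulmxBl cc ch hc opprK //.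
have -> : 1%:M - N = (1%:M - h) *m (1%:M - h).
  rewrite -hh !(mulmxDl, mulmxDr, mulmxN, mulNmx, mulmx1, mul1mx, h2).
  by apply/matrixP=> i j; rewrite !mxE; ring.
have detE : \det (1%:M + h) = \det (1%:M - h).
  by rewrite -chc !det_mulmx mulrAC -det_mulmx cc det1 mul1r.
rewrite det_mulmx -{2}detE -det_mulmx.
rewrite !(mulmxDl, mulmxDr, mulmxN, mulNmx, mulmx1, mul1mx, h2) subr0.
by rewrite addrK det1.
Qed.

(** The hypothesis says that E is invariant under A, so that A is block upper
triangular; removing the upper right block N changes the determinant of X - A
only by the factor det(1 - N) = 1. *)
Lemma char_poly_block_triangular (F : fieldType) n (E A : 'M[F]_n) : 2 != 0 :> F ->
  E *m E = E -> E *m A *m E = A *m E ->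
  char_poly (A - E *m A + E *m A *m E) = char_poly A.
Proof.
move=> two_neq0 EE EAE; set D := _ + _; pose N := E *m A - E *m A *m E.
have DE : D *m E = E *m D.
  rewrite !(mulmxDl, mulmxDr, mulmxN, mulNmx, mulmxA, EE) -!mulmxA EE !mulmxA.
  by rewrite EAE !subrr.
have EN : E *m N = N by rewrite mulmxBr !mulmxA EE.
have NE : N *m E = 0 by rewrite mulmxBl -[_ *m E *m E]mulmxA EE subrr.
have AE : A = D + N by rewrite /D /N -addrA subrKC subrK.
clearbody N.
pose C (M : 'M[F]_n) : 'M[{poly F}]_n := map_mx polyC M.
have CM X Y : C X *m C Y = C (X *m Y) by rewrite /C map_mxM.
pose M := char_poly_mx D.
have ME : M *m C E = C E *m M.
  rewrite /M /char_poly_mx mulmxBl mulmxBr scalar_mxC; congr (_ - _).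
  by rewrite -!map_mxM DE.
have CEE : C E *m C E = C E by rewrite CM EE.
have CEN : C E *m C N = C N by rewrite CM EN.
have CNE : C N *m C E = 0 by rewrite CM NE /C map_mx0.
have AM : char_poly_mx A = M - C N.
  by rewrite {1}AE /M /char_poly_mx map_mxD opprD addrA.
rewrite /char_poly AM (triangular_factor CEE ME CEN CNE) !det_mulmx -/M.
have -> : \det (1%:M - C N) = 1.
  have -> : 1%:M - C N = C (1%:M - N) by rewrite /C map_mxB map_mx1.
  by rewrite det_map_mx (det_unipotent two_neq0 EN NE EE).
rewrite mulr1 -det_mulmx; congr (\det _).
have := triangular_factor CEE ME (mulmx0 _ _) (mul0mx _ _).
by rewrite !subr0 mulmx1.
Qed.

Lemma char_poly_trmx (F : comNzRingType) n (A : 'M[F]_n) :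
  char_poly A^T = char_poly A.
Proof.
rewrite /char_poly -det_tr; congr (\det _).
by rewrite /char_poly_mx linearB /= tr_scalar_mx map_trmx trmxK.
Qed.

(** * Trace preservers of the commutant of a rank one idempotent *)

Lemma comm_tr (R : comPzSemiRingType) n (E X : 'M[R]_n) :
  E^T = E -> X *m E = E *m X -> X^T *m E = E *m X^T.
Proof. by move=> E_sym cX; rewrite -{1}E_sym -trmx_mul -cX trmx_mul E_sym. Qed.

Section TracePreservers.
Variables (R : realFieldType) (n : nat) (E : 'M[R]_n).
Hypothesis E_sym : E^T = E.

Local Notation comm X := (X *m E = E *m X).

(** The commutant of a symmetric E is closed under transposition, and
tr(Z Z^t) is the sum of the squares of the entries of Z. *)
Lemma comm_trace_nondeg Z : comm Z ->
  (forall Y, comm Y -> \tr (Z *m Y) = 0) -> Z = 0.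
Proof.
move=> cZ /(_ _ (comm_tr E_sym cZ)) trZ; apply/matrixP=> i j; rewrite [RHS]mxE.
have ge0 k l : 0 <= Z k l * Z^T l k by rewrite mxE -expr2 sqr_ge0.
have /eqP := trZ; rewrite psumr_eq0 => [/allP/(_ i (mem_index_enum _))|k _].
  rewrite mxE psumr_eq0 // => /allP/(_ j (mem_index_enum _)).
  by rewrite /= mxE mulf_eq0 orbb => /eqP.
by rewrite mxE sumr_ge0.
Qed.

(** Preserving a nondegenerate form, psi is injective on the commutant, which it
maps to itself: surjectivity is a dimension count. *)
Lemma comm_trace_surj (psi : {linear 'M[R]_n -> 'M[R]_n}) :
  (forall X, comm (psi X)) ->
  (forall X Y, comm X -> comm Y -> \tr (psi X *m psi Y) = \tr (X *m Y)) ->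
  forall Y, comm Y -> exists2 X, comm X & psi X = Y.
Proof.
move=> psi_comm psi_tr.
pose ad : {linear 'M[R]_n -> 'M[R]_n} := mulmxr E \- mulmx E.
pose D := lker (linfun ad); pose p := linfun psi.
have DP X : reflect (comm X) (X \in D).
  by rewrite memv_ker lfunE /= subr_eq0; exact: eqP.
have pD : (p @: D <= D)%VS.
  by apply/subvP=> _ /memv_imgP[X _ ->]; apply/DP; rewrite lfunE.
have kerD : (D :&: lker p)%VS = 0%VS.
  apply/eqP; rewrite -subv0; apply/subvP=> X; rewrite memv_cap memv_ker lfunE /=.
  case/andP=> /DP cX /eqP pX; rewrite memv0; apply/eqP.
  by apply: comm_trace_nondeg => // Y cY; rewrite -psi_tr // pX mul0mx mxtrace0.
have {}pD : (p @: D)%VS = D by apply/eqP; rewrite eqEdim pD limg_dim_eq /=.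
move=> Y /DP; rewrite -{1}pD => /memv_imgP[X /DP cX ->].
by exists X; rewrite ?lfunE.
Qed.

End TracePreservers.

Lemma idempotent_split (F : fieldType) n (Q : 'M[F]_n) : Q *m Q = Q ->
  exists V : 'M[F]_(n, \rank Q), exists2 W : 'M[F]_(\rank Q, n),
    V *m W = Q & W *m V = 1%:M.
Proof.
move=> QQ; exists (col_base Q), (row_base Q); first exact: mulmx_base.
have VW : col_base Q *m row_base Q = Q by exact: mulmx_base.
apply: (row_free_inj (row_base_free Q)); apply: (row_full_inj (col_base_full Q)).
by rewrite /= mul1mx mulmxA mulmxA VW -mulmxA VW QQ.
Qed.

(** The right multiples G B of a nonzero G with a nonzero entry in column a
include a nonzero matrix supported in any other column, and another one
supported in column a: they do not lie on one line. *)
Lemma mx_stable_line_eq0 (F : fieldType) m (G : 'M[F]_m) : (1 < m)%N ->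
  (forall B : 'M[F]_m, exists a, G *m B = a *: G) -> G = 0.
Proof.
move=> m_gt1 GB; apply/eqP; apply: contraT => /matrix0Pn[i [a Gia]].
have [b ba] : exists b : 'I_m, b != a.
  have m_gt0 := ltnW m_gt1.
  have [->|?] := eqVneq a (Ordinal m_gt0); first by exists (Ordinal m_gt1).
  by exists (Ordinal m_gt0); rewrite eq_sym.
have [mu Gmu] := GB (delta_mx a b).
have GdE c : (G *m delta_mx a b) i c = G i a * (c == b)%:R.
  rewrite mxE (bigD1 a) //= big1 => [|k ka]; first by rewrite mxE eqxx addr0.
  by rewrite mxE (negPf ka) mulr0.
have := GdE a; rewrite eq_sym (negPf ba) mulr0 Gmu mxE => /eqP.
rewrite mulf_eq0 (negPf Gia) orbF => /eqP mu0.
by have := GdE b; rewrite eqxx mulr1 Gmu mu0 scale0r mxE => G0; rewrite -G0 eqxx in Gia.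
Qed.

(** The hypothesis on E X E says that E has rank one. The commutant of E is the
sum of the line of E and of the corner (1-E)M(1-E); the factors V and W of
1 - E identify that corner with the square matrices B of order m, through
B |-> V B W and X |-> W X V. *)
Section Commutant.
Variables (R : numFieldType) (n : nat) (E : 'M[R]_n).
Hypothesis EE : E *m E = E.
Hypothesis EXE : forall X, E *m X *m E = \tr (E *m X) *: E.
Hypothesis trE : \tr E = 1.
Hypothesis E_sym : E^T = E.

Local Notation comm X := (X *m E = E *m X).

Section Coordinates.
Variables (m : nat) (V : 'M[R]_(n, m)) (W : 'M[R]_(m, n)).
Hypothesis VW : V *m W = 1%:M - E.
Hypothesis WV : W *m V = 1%:M.

Let EV : E *m V = 0.
Proof.
have VWV : V *m W *m V = V by rewrite -mulmxA WV mulmx1.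
by rewrite -VWV VW mulmxA mulmxBr EE mulmx1 subrr mul0mx.
Qed.

Let WE : W *m E = 0.
Proof.
have WVW : W *m (V *m W) = W by rewrite mulmxA WV mul1mx.
by rewrite -WVW VW -mulmxA mulmxBl EE mul1mx subrr mulmx0.
Qed.

(** Both sides are the trace of 1 - E = V W. *)
Lemma corner_size : m%:R = n%:R - 1 :> R.
Proof. by rewrite -[LHS]mxtrace1 -WV mxtrace_mulC VW raddfB /= mxtrace1 trE. Qed.

Lemma comm_lift B : comm (V *m B *m W).
Proof. by rewrite -mulmxA WE !mulmxA EV mulmx0 !mul0mx. Qed.

Lemma comm_decomp X : comm X ->
  X = \tr (E *m X) *: E + V *m (W *m X *m V) *m W.
Proof.
move=> cX; have -> : V *m (W *m X *m V) *m W = (V *m W) *m X *m (V *m W).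
  by rewrite !mulmxA.
rewrite -EXE VW !(mulmxDl, mulmxDr, mulmxN, mulNmx, mulmx1, mul1mx) cX.
rewrite -!mulmxA cX mulmxA EE.
by move: (E *m X) => Z; apply/matrixP=> i j; rewrite !mxE; ring.
Qed.

Lemma corner_mul X Y : comm X ->
  W *m (X *m Y) *m V = (W *m X *m V) *m (W *m Y *m V).
Proof.
move=> cX; rewrite !mulmxA -[W *m X *m V *m W]mulmxA VW mulmxBr mulmx1.
by rewrite -[W *m X *m E]mulmxA cX !mulmxA WE !mul0mx subr0.
Qed.

Lemma corner_lift B : W *m (V *m B *m W) *m V = B.
Proof. by rewrite !mulmxA WV mul1mx -mulmxA WV mulmx1. Qed.

Lemma corner_scale_E a : W *m (a *: E) *m V = 0.
Proof. by rewrite -scalemxAr WE scaler0 mul0mx. Qed.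

Lemma conj_lift T a B : (E + V *m T *m W) *m (a *: E + V *m B *m W) =
  a *: E + V *m (T *m B) *m W.
Proof.
have VTWE : V *m T *m W *m E = 0 by rewrite -mulmxA WE mulmx0.
have EVBW : E *m (V *m B *m W) = 0 by rewrite !mulmxA EV !mul0mx.
rewrite mulmxDl !mulmxDr -!scalemxAr EE EVBW VTWE scaler0 addr0 add0r.
by rewrite !mulmxA -[V *m T *m W *m V]mulmxA WV mulmx1.
Qed.

Lemma lift_conj T a B : (a *: E + V *m B *m W) *m (E + V *m T *m W) =
  a *: E + V *m (B *m T) *m W.
Proof.
have VBWE : V *m B *m W *m E = 0 by rewrite -mulmxA WE mulmx0.
have EVTW : E *m (V *m T *m W) = 0 by rewrite !mulmxA EV !mul0mx.
rewrite mulmxDl !mulmxDr -!scalemxAl EE EVTW VBWE scaler0 addr0 add0r.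
by rewrite !mulmxA -[V *m B *m W *m V]mulmxA WV mulmx1.
Qed.

Lemma lift_unit T : T \in unitmx -> E + V *m T *m W \in unitmx.
Proof.
move=> Tu; suff /mulmx1_unit[] :
  (E + V *m T *m W) *m (1 *: E + V *m invmx T *m W) = 1%:M by [].
by rewrite conj_lift mulmxV // mulmx1 scale1r VW subrKC.
Qed.

Variable psi : {linear 'M[R]_n -> 'M[R]_n}.
Hypothesis psi_comm : forall X, comm (psi X).
Hypothesis psi_surj : forall Y, comm Y -> exists2 X, comm X & psi X = Y.
Hypothesis psi_sqr : forall X, comm X -> psi (X *m X) = psi X *m psi X.
Hypothesis psi_tr : forall X Y, comm X -> comm Y ->
  \tr (psi X *m psi Y) = \tr (X *m Y).
Hypothesis n_gt2 : (2 < n)%N.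

(** Since E X = c E on the commutant, F = psi E satisfies Y F + F Y = 2 c F for
all Y in the commutant.  As F is idempotent, multiplying by F on either side
shows that F and Y commute, so F Y lies on the line of F.  In the corner, of
order at least 2, this forces the component of F to vanish; thus F is a
multiple of E, and its trace is 1. *)
Lemma comm_psi_E : psi E = E.
Proof.
have two_neq0 : 2 != 0 :> R by rewrite pnatr_eq0.
set F := psi E.
have FF : F *m F = F by rewrite -psi_sqr ?EE.
have anti X : comm X -> psi X *m F + F *m psi X = (\tr (E *m X) * 2) *: F.
  move=> cX; have cXE : comm (X + E) by rewrite mulmxDl mulmxDr cX.
  have EX : E *m X = \tr (E *m X) *: E by rewrite -EXE -mulmxA cX mulmxA EE.
  have psiEX : psi (E *m X) = \tr (E *m X) *: F by rewrite EX linearZ mxtraceZ trE mulr1.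
  apply: (addIr (psi X *m psi X + F)).
  transitivity (psi (X + E) *m psi (X + E)).
    rewrite [psi (X + E)]linearD mulmxDl !mulmxDr -/F FF.
    move: (psi X *m psi X) (psi X *m F) (F *m psi X) => A B C.
    by apply/matrixP=> i j; rewrite !mxE; ring.
  rewrite -psi_sqr // -psi_sqr // mulmxDl !mulmxDr cX EE.
  rewrite [psi _]linearD [psi (_ + E)]linearD [psi (_ + E *m X)]linearD psiEX -/F.
  by apply/matrixP=> i j; rewrite !mxE; ring.
have absorb Y : comm Y -> exists a, F *m Y = a *: F.
  move=> /psi_surj[X cX <-]; have aX := anti X cX; exists (\tr (E *m X)).
  have e1 : F *m psi X *m F + F *m psi X = (\tr (E *m X) * 2) *: F.
    by rewrite -[F in RHS]FF scalemxAr -aX mulmxDr !mulmxA FF.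
  have e2 : psi X *m F + F *m psi X *m F = (\tr (E *m X) * 2) *: F.
    by rewrite -[F in RHS]FF scalemxAl -aX mulmxDl -[psi X *m F *m F]mulmxA FF.
  have e3 : psi X *m F = F *m psi X.
    by apply: (addIr (F *m psi X *m F)); rewrite e2 -e1 addrC.
  move: aX; rewrite e3 -mulr2n -scaler_nat mulrC -scalerA.
  exact: (scalerI two_neq0).
have m_gt1 : (1 < m)%N.
  have : m.+1%:R = n%:R :> R by rewrite -natr1 corner_size subrK.
  by move/(mulrIn (oner_neq0 R)) => mn; rewrite -ltnS mn.
have F0 : W *m F *m V = 0.
  apply: (mx_stable_line_eq0 m_gt1) => B; have [a Fa] := absorb _ (comm_lift B).
  exists a; have := congr1 (fun M => W *m M *m V) Fa.
  by rewrite /= (corner_mul _ (psi_comm _)) corner_lift -scalemxAr -scalemxAl.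
have FE := comm_decomp (psi_comm E); rewrite -/F F0 mulmx0 mul0mx addr0 in FE.
have : \tr (F *m F) = 1 by rewrite psi_tr // EE.
by rewrite FF {1}FE mxtraceZ trE mulr1 => F1; rewrite FE F1 scale1r.
Qed.

(** The map that psi induces on the corner. *)
Let theta : {linear 'M[R]_m -> 'M[R]_m} :=
  mulmxr V \o mulmx W \o psi \o mulmxr W \o mulmx V.

Let thetaE B : theta B = W *m psi (V *m B *m W) *m V. Proof. by []. Qed.

Let psi_decomp X : comm X ->
  psi X = \tr (E *m X) *: E + V *m theta (W *m X *m V) *m W.
Proof.
move=> cX; rewrite {1}(comm_decomp cX) linearD linearZ /= comm_psi_E; congr (_ + _).
rewrite [LHS](comm_decomp (psi_comm _)) -{1}comm_psi_E psi_tr.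
- by rewrite !mulmxA EV !mul0mx mxtrace0 scale0r add0r.
- by [].
- exact: comm_lift.
Qed.

Let theta_sqr B : theta (B * B) = theta B * theta B.
Proof.
rewrite -!mulmxE !thetaE -corner_mul // -psi_sqr; last exact: comm_lift.
by rewrite !mulmxA -[V *m B *m W *m V]mulmxA WV mulmx1.
Qed.

Let theta_surj Y : exists B, theta B = Y.
Proof.
have [X cX XY] := psi_surj (comm_lift Y); exists (W *m X *m V).
rewrite -[RHS]corner_lift -XY (psi_decomp cX) mulmxDr mulmxDl corner_scale_E.
by rewrite add0r corner_lift.
Qed.

(** The map theta of the corner is conjugation by T, possibly composed with
transposition, and P acts as 1 on E and as T on the corner. In the second case
the transpose of the coordinates W X V of X differs from the coordinates of
X^T, because V and W^T are distinct; the two are conjugate under N = V^T V, so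
that T has to be replaced by T N. *)
Lemma commutant_jordan_inner : exists P, [/\ comm P, P \in unitmx &
  (forall X, comm X -> psi X = P *m X *m invmx P) \/
  (forall X, comm X -> psi X = P *m X^T *m invmx P)].
Proof.
have two_neq0 : 2 != 0 :> R by rewrite pnatr_eq0.
have commP T : comm (E + V *m T *m W) by rewrite mulmxDl mulmxDr comm_lift.
have conjP P M X : P \in unitmx -> M *m P = P *m X -> M = P *m X *m invmx P.
  by move=> Pu <-; rewrite mulmxK.
have [thM|thM] := jordan_mult_or_antimult two_neq0 theta_sqr theta_surj.
  have [T Tu thT] := mult_surj_inner thM theta_surj.
  exists (E + V *m T *m W); split; [exact: commP | exact: lift_unit | left=> X cX].
  apply: conjP; first exact: lift_unit.
  rewrite psi_decomp // lift_conj {3}(comm_decomp cX) conj_lift.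
  by rewrite thT -!mulmxE mulmxKV.
pose theta' : {linear 'M[R]_m -> 'M[R]_m} := theta \o trmx.
have thM' A B : theta' (A * B) = theta' A * theta' B.
  rewrite /theta' [LHS]/= [RHS]/= -thM; congr (theta _); exact: trmx_mul.
have th_surj' Y : exists B, theta' B = Y.
  by have [B <-] := theta_surj Y; exists B^T; rewrite /theta' /= trmxK.
have [T Tu thT] := mult_surj_inner thM' th_surj'.
have {}thT B : theta B = T *m B^T *m invmx T.
  by rewrite -[B in LHS]trmxK; exact: thT.
have VE : V^T *m E = 0 by rewrite -{1}E_sym -trmx_mul EV trmx0.
pose N := V^T *m V.
have Nu : N \in unitmx.
  suff /mulmx1_unit[] : N *m (W *m W^T) = 1%:M by [].
  rewrite /N !mulmxA -[_ *m V *m W]mulmxA VW mulmxBr VE subr0 mulmx1.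
  by rewrite -trmx_mul WV trmx1.
exists (E + V *m (T *m N) *m W); split; first exact: commP.
  by apply: lift_unit; rewrite unitmx_mul Tu.
right=> X cX; apply: conjP; first by apply: lift_unit; rewrite unitmx_mul Tu.
have cXT := comm_tr E_sym cX.
have trX : \tr (E *m X^T) = \tr (E *m X).
  by rewrite -mxtrace_tr trmx_mul trmxK E_sym mxtrace_mulC.
have NX : (W *m X *m V)^T *m N = N *m (W *m X^T *m V).
  rewrite /N !trmx_mul !mulmxA -[_ *m W^T *m V^T]mulmxA -(trmx_mul V W) VW.
  rewrite -[V^T *m V *m W]mulmxA VW linearB /= trmx1 E_sym !mulmxBr VE subr0 !mulmx1.
  by rewrite mulmxBl -[_ *m E *m V]mulmxA EV mulmx0 subr0.
rewrite psi_decomp // lift_conj {1}(comm_decomp cXT) conj_lift trX thT.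
congr (_ + V *m _ *m W).
by rewrite [LHS]mulmxA mulmxKV // -[LHS]mulmxA NX mulmxA.
Qed.

End Coordinates.
End Commutant.

(** * The averaging matrix *)

Section Averaging.
Variables (R : realType) (n : nat).
Hypothesis n_gt0 : (0 < n)%N.

Implicit Types X Y A B : 'M[R]_n.

Definition avg_mx : 'M[R]_n := const_mx n%:R^-1.
Local Notation E := avg_mx.
Local Notation comm X := (X *m E = E *m X).

Let nN0 : n%:R != 0 :> R. Proof. by rewrite pnatr_eq0 -lt0n. Qed.

Lemma mulmx_avgE X i j : (X *m E) i j = n%:R^-1 * \sum_k X i k.
Proof. by rewrite mxE mulrC mulr_suml; apply: eq_bigr => k _; rewrite mxE. Qed.

Lemma mul_avg_mxE X i j : (E *m X) i j = n%:R^-1 * \sum_k X k j.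
Proof. by rewrite mxE mulr_sumr; apply: eq_bigr => k _; rewrite mxE. Qed.

Lemma avg_mx_sym : E^T = E.
Proof. exact: trmx_const. Qed.

Lemma avg_mx_tr : \tr E = 1.
Proof.
rewrite /mxtrace; under eq_bigr do rewrite mxE.
by rewrite sumr_const card_ord -[LHS]mulr_natl mulfV.
Qed.

Lemma avg_mx_sandwich X : E *m X *m E = \tr (E *m X) *: E.
Proof.
apply/matrixP=> i j; rewrite mulmx_avgE !mxE mulrC; congr (_ * _).
by apply: eq_bigr => k _; rewrite !mul_avg_mxE.
Qed.

Lemma avg_mx_idem : E *m E = E.
Proof. by rewrite -{1}[E]mulmx1 avg_mx_sandwich mulmx1 avg_mx_tr scale1r. Qed.

Lemma lspan_RS_avg (A : 'M[R]_n) : A \in in_lspan (RS R n) -> E *m A *m E = A *m E.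
Proof.
move=> /in_lspan_RS rowA; apply/matrixP=> i j; rewrite -mulmxA mul_avg_mxE.
under eq_bigr do rewrite mulmx_avgE (rowA _ i).
rewrite mulmx_avgE sumr_const card_ord -[X in _ * X]mulr_natl mulKf //.
Qed.

(** The (i, j) entries of A E and E A are the i-th row sum and the j-th column
sum of A, divided by n. *)
Lemma comm_lspan_DS A : comm A -> A \in in_lspan (DS R n).
Proof.
move=> cA; have rc i j : \sum_k A i k = \sum_k A k j.
  have /matrixP/(_ i j) := cA; rewrite mulmx_avgE mul_avg_mxE.
  by apply: mulfI; rewrite invr_eq0.
pose i0 := Ordinal n_gt0; apply: (in_lspan_DS (s := \sum_k A i0 k)) => // i.
by rewrite (rc i i0) (rc i0 i0).
Qed.

Lemma lspan_DS_RS A : A \in in_lspan (DS R n) -> A \in in_lspan (RS R n).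
Proof.
case/in_lspanP=> s sDS As; apply/in_lspanP; exists s => // X /sDS[X_ge0 X_row _].
by split.
Qed.

Lemma DSpartE (A : 'M[R]_n) : DSpart A = A - E *m A + E *m A *m E.
Proof.
apply/matrixP=> i j.
rewrite [LHS]mxE [RHS]mxE [(A - _) i j]mxE [(- Rpart A) i j]mxE [(- (E *m A)) i j]mxE.
rewrite mulmx_avgE mul_avg_mxE -addrA; congr (_ + _).
rewrite mxE big_ord1 !mxE mul1r opprB addrC; congr (_ + _).
under [in RHS]eq_bigr do rewrite mul_avg_mxE.
by rewrite -mulr_sumr mulrA -expr2 exprVn exchange_big.
Qed.

Fact DSpart_is_linear : linear (@DSpart R n).
Proof.
move=> a A B; rewrite !DSpartE !(mulmxDr, mulmxDl) -!(scalemxAr, scalemxAl).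
rewrite !scalerDr !scalerN.
by move: (E *m A *m E) => X; apply/matrixP=> i j; rewrite !mxE; ring.
Qed.
HB.instance Definition _ := GRing.isLinear.Build R 'M[R]_n 'M[R]_n _ (@DSpart R n)
  DSpart_is_linear.

Lemma comm_DSpart A : comm A -> DSpart A = A.
Proof. by move=> cA; rewrite DSpartE -cA -mulmxA avg_mx_idem subrK. Qed.

Lemma DSpart_comm A : A \in in_lspan (RS R n) -> comm (DSpart A).
Proof.
move=> /lspan_RS_avg EAE; rewrite DSpartE !(mulmxDl, mulmxDr, mulmxN, mulNmx).
by rewrite -!mulmxA avg_mx_idem !mulmxA avg_mx_idem EAE !subrr.
Qed.

Lemma char_poly_DSpart A : A \in in_lspan (RS R n) ->
  char_poly (DSpart A) = char_poly A.
Proof.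
move=> /lspan_RS_avg EAE; rewrite DSpartE char_poly_block_triangular ?avg_mx_idem //.
by rewrite pnatr_eq0.
Qed.

Definition comm_proj (X : 'M[R]_n) : 'M[R]_n :=
  E *m X *m E + (1%:M - E) *m X *m (1%:M - E).

Lemma comm_proj_comm X : comm (comm_proj X).
Proof.
have EQ : E *m (1%:M - E) = 0 by rewrite mulmxBr mulmx1 avg_mx_idem subrr.
have QE : (1%:M - E) *m E = 0 by rewrite mulmxBl mul1mx avg_mx_idem subrr.
move: QE EQ; rewrite /comm_proj; move: (1%:M - E) => Q QE EQ.
rewrite mulmxDl mulmxDr -!mulmxA QE !mulmx0 [E *m (Q *m _)]mulmxA EQ mul0mx.
by rewrite !mulmxA avg_mx_idem -!mulmxA avg_mx_idem.
Qed.

Lemma comm_proj_id X : comm X -> comm_proj X = X.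
Proof.
move=> cX; rewrite /comm_proj !(mulmxDl, mulmxDr, mulmxN, mulNmx, mulmx1, mul1mx).
rewrite cX -!mulmxA cX !mulmxA avg_mx_idem.
by move: (E *m X) => Z; apply/matrixP=> i j; rewrite !mxE; ring.
Qed.

(** Projecting onto the commutant first makes this map total and linear on all
square matrices. *)
Definition to_lspan_RS (X : 'M[R]_n) : lspan (RS R n) :=
  Lspan (lspan_DS_RS (comm_lspan_DS (comm_proj_comm X))).

Fact to_lspan_RS_is_linear : linear to_lspan_RS.
Proof.
move=> a X Y; apply: val_inj; rewrite linearP /= /comm_proj; move: (1%:M - E) => Q.
rewrite !(mulmxDr, mulmxDl) -!(scalemxAr, scalemxAl) scalerDr.
by rewrite addrACA.
Qed.
HB.instance Definition _ := GRing.isLinear.Build R _ _ _ to_lspan_RS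
  to_lspan_RS_is_linear.

End Averaging.

(** * Order two *)

Lemma ord2_ind (P : 'I_2 -> Prop) : P 0 -> P 1 -> forall i, P i.
Proof.
by move=> P0 P1 [[|[|//]] h]; [move: P0 | move: P1]; congr (P _); exact: val_inj.
Qed.

Lemma sum_eq1_sum_sqr_eq1 (R : realFieldType) (a b : R) :
  a + b = 1 -> a * a + b * b = 1 -> (a = 1 /\ b = 0) \/ (a = 0 /\ b = 1).
Proof.
move=> ab1 sq1; have bE : b = 1 - a by rewrite -ab1 addrAC subrr add0r.
have : a * b = 0.
  have two0 : 2 != 0 :> R by rewrite pnatr_eq0.
  apply: (mulfI two0); rewrite mulr0 bE.
  have -> : 2 * (a * (1 - a)) = 1 - (a * a + (1 - a) * (1 - a)) by ring.
  by rewrite -bE sq1 subrr.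
move/eqP; rewrite mulf_eq0 => /orP[] /eqP z0; [right | left]; move: ab1.
  by rewrite z0 add0r.
by rewrite z0 addr0.
Qed.

Section Dimension2.
Variable R : realType.
Local Notation E := (avg_mx R 2).
Local Notation Q := (1%:M - E).
Local Notation comm X := (X *m E = E *m X).

Lemma altdiagK : altdiag R 2 *m altdiag R 2 = 1%:M.
Proof.
apply/matrixP=> i j; rewrite mul_diag_mx !mxE.
by elim/ord2_ind: i; elim/ord2_ind: j; rewrite /= ?expr0 ?expr1 ?mulr0n ?mulr1n; ring.
Qed.

Lemma altdiag_unit : altdiag R 2 \in unitmx.
Proof. by case/mulmx1_unit: altdiagK. Qed.

Lemma invmx_altdiag : invmx (altdiag R 2) = altdiag R 2.
Proof. by rewrite -[LHS]mulmx1 -altdiagK mulKmx // altdiag_unit. Qed.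

Lemma altdiag_avg : altdiag R 2 *m E *m altdiag R 2 = Q.
Proof.
apply/matrixP=> i j; rewrite mul_mx_diag mul_diag_mx !mxE.
have two0 : 2 != 0 :> R by rewrite pnatr_eq0.
by elim/ord2_ind: i; elim/ord2_ind: j; rewrite /= ?expr0 ?expr1 ?mulr0n ?mulr1n; field.
Qed.

(** The coefficients are the eigenvalues of X, on (1, 1) and on (1, -1). *)
Lemma comm_dim2 X : comm X -> exists a b, X = a *: E + b *: Q.
Proof.
move=> cX; exists (X 0 0 + X 0 1), (X 0 0 - X 0 1).
have two0 : 2 != 0 :> R by rewrite pnatr_eq0.
have rc i j : X i 0 + X i 1 = X 0 j + X 1 j.
  have /matrixP/(_ i j) := cX; rewrite mulmx_avgE mul_avg_mxE !big_ord_recl !big_ord0.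
  rewrite !addr0; have -> : lift 0 0 = 1 :> 'I_2 by exact: val_inj.
  by apply: mulfI; rewrite invr_eq0.
have e0 : X 1 0 = X 0 1 by apply: (addrI (X 0 0)); rewrite -(rc 0 0).
have e1 : X 1 1 = X 0 0 by apply: (addrI (X 0 1)); rewrite -(rc 0 1) addrC.
apply/matrixP=> i j; rewrite !mxE.
by elim/ord2_ind: i; elim/ord2_ind: j; rewrite ?e0 ?e1 /= ?mulr0n ?mulr1n; field.
Qed.

End Dimension2.

(** * Spectrum preservers *)

Section SpectrumPreserver.
Variables (R : realType) (n : nat) (n_gt0 : (0 < n)%N).
Variable phi : {linear lspan (RS R n) -> lspan (RS R n)}.
Hypothesis phi_spec : forall A, spec (\val (phi A)) = spec (\val A).
Local Notation E := (avg_mx R n).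
Local Notation comm X := (X *m E = E *m X).

Let ds : {linear lspan (RS R n) -> 'M[R]_n} := @DSpart R n \o \val.
Let ds_phi : {linear lspan (RS R n) -> 'M[R]_n} := ds \o phi.

Let ds_comm A : comm (ds A).
Proof. exact/DSpart_comm/valP. Qed.

Let ds_to X : comm X -> ds (to_lspan_RS n_gt0 X) = X.
Proof. by move=> cX; rewrite /ds /= comm_proj_id // comm_DSpart. Qed.

Let char_poly_ds_phi A : char_poly (ds_phi A) = char_poly (ds A).
Proof.
rewrite /ds_phi /ds /= (char_poly_DSpart n_gt0 (valP A)).
by rewrite (char_poly_DSpart n_gt0 (valP (phi A))); apply/spec_char_poly.
Qed.

Definition ds_map : {linear 'M[R]_n -> 'M[R]_n} := ds_phi \o to_lspan_RS n_gt0.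

Lemma ds_map_comm X : comm (ds_map X).
Proof. exact: ds_comm. Qed.

Lemma ds_map_tr X Y : comm X -> comm Y ->
  \tr (ds_map X *m ds_map Y) = \tr (X *m Y).
Proof.
move=> cX cY; rewrite /ds_map /=.
by rewrite (eq_char_poly_mxtrace_mul char_poly_ds_phi) !ds_to.
Qed.

Lemma ds_map_tr1 X : comm X -> \tr (ds_map X) = \tr X.
Proof. by move=> cX; rewrite /ds_map /= (eq_char_poly_mxtrace char_poly_ds_phi) ds_to. Qed.

Lemma ds_map_surj Y : comm Y -> exists2 X, comm X & ds_map X = Y.
Proof.
exact: (comm_trace_surj (avg_mx_sym R n) ds_map_comm ds_map_tr).
Qed.

(** The defect psi(XX) - psi(X)psi(X) is orthogonal to every psi(Y) for the trace
form, hence to the whole commutant. *)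
Lemma ds_map_sqr X : comm X -> ds_map (X *m X) = ds_map X *m ds_map X.
Proof.
move=> cX; have sqC Z : comm Z -> comm (Z *m Z).
  by move=> cZ; rewrite -mulmxA cZ !mulmxA cZ.
have commB A B : comm A -> comm B -> comm (A - B).
  by move=> cA cB; rewrite mulmxBl mulmxBr cA cB.
have cXX := sqC _ cX.
apply/eqP; rewrite -subr_eq0; apply/eqP.
apply: (comm_trace_nondeg (avg_mx_sym R n)) => [|_ /ds_map_surj[Y cY <-]].
  by apply: commB; [exact: ds_map_comm | exact/sqC/ds_map_comm].
rewrite (mulmxBl (ds_map _) (_ *m _)) raddfB /= ds_map_tr //.
apply/eqP; rewrite subr_eq0; apply/eqP.
by rewrite /ds_map /= (eq_char_poly_mxtrace_sqr_mul char_poly_ds_phi) !ds_to.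
Qed.

(** Let N be the difference of A and its component in <DS>. Then phi(N)_DS is
orthogonal to phi(Y)_DS for all Y in <DS>, which fill the commutant. *)
Lemma ds_phiE A : DSpart (\val (phi A)) = ds_map (DSpart (\val A)).
Proof.
apply/eqP; rewrite -subr_eq0; apply/eqP.
pose N := A - to_lspan_RS n_gt0 (ds A).
have dsN : ds N = 0 by rewrite linearB ds_to ?subrr.
have -> : DSpart (\val (phi A)) - ds_map (DSpart (\val A)) = ds_phi N.
  by rewrite [RHS]linearB.
apply: (comm_trace_nondeg (avg_mx_sym R n)) => [|_ /ds_map_surj[Y cY <-]].
  exact: ds_comm.
by rewrite /ds_map /= (eq_char_poly_mxtrace_mul char_poly_ds_phi) dsN mul0mx mxtrace0.
Qed.

End SpectrumPreserver.

(** On a E + b (1-E) the traces of X and of XX are a + b and a^2 + b^2.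
Preserving them at 1 gives psi 1 = 1; preserving them at E, where they are 1
and 1, leaves psi E = E or psi E = 1 - E. *)
Lemma ds_map_dim2 (R : realType) (phi : {linear lspan (RS R 2) -> lspan (RS R 2)}) :
  (forall A, spec (\val (phi A)) = spec (\val A)) ->
  exists P : 'M[R]_2, (P = 1%:M \/ P = altdiag R 2) /\
    forall X : 'M[R]_2, X *m avg_mx R 2 = avg_mx R 2 *m X ->
      ds_map (isT : 0 < 2)%N phi X = P *m X *m invmx P.
Proof.
move=> phi_spec; set psi := ds_map _ phi; set E := avg_mx R 2.
pose Q : 'M[R]_2 := 1%:M - E.
have n2 : (0 < 2)%N by [].
have EE : E *m E = E := avg_mx_idem R n2.
have trE : \tr E = 1 := avg_mx_tr R n2.
have EQ : E *m Q = 0 by rewrite mulmxBr mulmx1 EE subrr.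
have QE : Q *m E = 0 by rewrite mulmxBl mul1mx EE subrr.
have QQ : Q *m Q = Q by rewrite {1}/Q mulmxBl mul1mx EQ subr0.
have trQ : \tr Q = 1 by rewrite raddfB /= mxtrace1 trE; ring.
have form (X : 'M[R]_2) : X *m E = E *m X -> exists a b,
    [/\ psi X = a *: E + b *: Q, a + b = \tr X & a * a + b * b = \tr (X *m X)].
  move=> cX; have [a [b ab]] := comm_dim2 (ds_map_comm (isT : 0 < 2)%N phi X).
  exists a, b; rewrite -(ds_map_tr (isT : 0 < 2)%N phi_spec cX cX).
  rewrite -(ds_map_tr1 (isT : 0 < 2)%N phi_spec cX).
  rewrite -/psi in ab *; rewrite ab; split=> //.
    by rewrite mxtraceD !mxtraceZ trE trQ !mulr1.
  rewrite mulmxDl !mulmxDr -!(scalemxAl, scalemxAr) EE EQ QE QQ !scaler0.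
  by rewrite addr0 add0r mxtraceD !mxtraceZ trE trQ !mulr1.
have two0 : 2 != 0 :> R by rewrite pnatr_eq0.
have psi1 : psi 1%:M = 1%:M.
  have [|a [b [-> ab2 sq2]]] := form 1%:M; first by rewrite mulmx1 mul1mx.
  rewrite mxtrace1 in ab2; rewrite mulmx1 mxtrace1 in sq2.
  (* a + b = 2 and a^2 + b^2 = 2 give 2 (a - 1)^2 = 0. *)
  have ab : a = 1 /\ b = 1.
    have bE : b = 2 - a by rewrite -ab2 addrAC subrr add0r.
    have : (a - 1) * (a - 1) = 0.
      apply: (mulfI two0); rewrite mulr0.
      have -> : 2 * ((a - 1) * (a - 1)) = a * a + (2 - a) * (2 - a) - 2 by ring.
      by rewrite -bE sq2 subrr.
    move/eqP; rewrite mulf_eq0 orbb subr_eq0 => /eqP a1.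
    by rewrite bE a1; split=> //; ring.
  by have [-> ->] := ab; rewrite !scale1r /Q subrKC.
have psiQ : psi Q = 1%:M - psi E by rewrite linearB psi1.
have psiE X : X *m E = E *m X ->
    exists a b, X = a *: E + b *: Q /\ psi X = a *: psi E + b *: (1%:M - psi E).
  move=> /comm_dim2[a [b ->]]; exists a, b; split => //.
  by rewrite -psiQ linearD !linearZ.
have [//|a [b [psiEab ab1 sq1]]] := form E.
rewrite trE in ab1; rewrite EE trE in sq1.
have [[a1 b0]|[a0 b1]] := sum_eq1_sum_sqr_eq1 ab1 sq1.
  exists 1%:M; split=> [|X /psiE[c [d [-> ->]]]]; first by left.
  by rewrite invmx1 mulmx1 mul1mx psiEab a1 b0 scale1r scale0r addr0.
exists (altdiag R 2); split=> [|X /psiE[c [d [-> ->]]]]; first by right.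
rewrite psiEab a0 b1 scale1r scale0r add0r invmx_altdiag.
rewrite mulmxDr mulmxDl -!(scalemxAl, scalemxAr) altdiag_avg.
by rewrite /Q mulmxBr mulmxBl mulmx1 altdiagK altdiag_avg.
Qed.

Theorem theorem4p1 (R : realType) (n : nat) (n_ge2 : (2 <= n)%N)
    (phi : {linear lspan (RS R n) -> lspan (RS R n)}) :
  (forall A : lspan (RS R n), spec (\val (phi A)) = spec (\val A))
  <->
  (n = 2%N /\
     exists P : 'M[R]_n, (P = 1%:M \/ P = altdiag R n) /\
       forall A : lspan (RS R n),
         DSpart (\val (phi A)) = P *m DSpart (\val A) *m invmx P)
  \/
  ((3 <= n)%N /\
     exists P : 'M[R]_n, [/\ P \in in_lspan (DS R n), P \in unitmx &
       (forall A : lspan (RS R n),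
          DSpart (\val (phi A)) = P *m DSpart (\val A) *m invmx P)
       \/
       (forall A : lspan (RS R n),
          DSpart (\val (phi A)) = P *m (DSpart (\val A))^T *m invmx P)]).
Proof.
have n_gt0 : (0 < n)%N := ltnW n_ge2.
have dsC (A : lspan (RS R n)) := DSpart_comm n_gt0 (valP A).
split=> [phi_spec|].
  have phiE := ds_phiE n_gt0 phi_spec.
  have [n_eq2|n_gt2] := eqVneq n 2%N.
    left; split=> //; subst n.
    have [P [P1 PE]] := ds_map_dim2 phi_spec; exists P; split=> // A.
    by rewrite (ds_phiE (isT : 0 < 2)%N phi_spec) PE.
  have {}n_gt2 : (2 < n)%N by rewrite ltn_neqAle eq_sym n_gt2.
  right; split=> //.
  have EE := avg_mx_idem R n_gt0.
  have QQ : (1%:M - avg_mx R n) *m (1%:M - avg_mx R n) = 1%:M - avg_mx R n.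
    by rewrite mulmxBr mulmx1 mulmxBl mul1mx EE subrr subr0.
  have [V [W VW WV]] := idempotent_split QQ.
  have [P [cP Pu PE]] := commutant_jordan_inner EE (@avg_mx_sandwich R n) (avg_mx_tr R n_gt0)
    (avg_mx_sym R n) VW WV (ds_map_comm n_gt0 phi) (ds_map_surj n_gt0 phi_spec)
    (ds_map_sqr n_gt0 phi_spec) (ds_map_tr n_gt0 phi_spec) n_gt2.
  exists P; split=> //; first exact: comm_lspan_DS.
  by case: PE => PE; [left | right] => A; rewrite phiE PE.
have pres (P : 'M[R]_n) : P \in unitmx ->
    (forall A : lspan (RS R n),
       DSpart (\val (phi A)) = P *m DSpart (\val A) *m invmx P)
    \/ (forall A : lspan (RS R n),
       DSpart (\val (phi A)) = P *m (DSpart (\val A))^T *m invmx P) ->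
    forall A : lspan (RS R n), spec (\val (phi A)) = spec (\val A).
  move=> Pu phiP A; apply/spec_char_poly.
  rewrite -(char_poly_DSpart n_gt0 (valP (phi A))) -(char_poly_DSpart n_gt0 (valP A)).
  by case: phiP => ->; rewrite char_poly_conj // char_poly_trmx.
case=> [[n_eq2 [P [P_eq phiP]]]|[_ [P [_ Pu phiP]]]]; last exact: pres phiP.
apply: (pres P); last by left.
by case: P_eq => ->; [exact: unitmx1 | subst n; exact: altdiag_unit].
Qed.
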